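(* Let $p$ be a prime, $59/60\le\alpha<1$, $\gamma=1-\alpha$, $\beta<\alpha^3$ and $\epsilon=\alpha^3-\beta>0$. Then $$n_p(\alpha,\beta)\le\mathrm{Tow}\!\left(p,\frac{\log\epsilon}{\log(36\gamma)}+9,\frac1\epsilon\right).$$
   Context: For a prime $p$, $A\subseteq\mathbb{F}_p^n$ has density $|A|/p^n$; the density of 3-APs in $A$ with common difference $d$ is $p^{-n}|\{x: x,x+d,x+2d\in A\}|$. $n_p(\alpha,\beta)$ is the least positive integer $N$ such that for all $n\ge N$ and all $A\subseteq\mathbb{F}_p^n$ of density at least $\alpha$ some nonzero $d$ has 3-AP density at least $\beta$. $\mathrm{Tow}(a,0,r)=r$, $\mathrm{Tow}(a,k+1,r)=a^{\mathrm{Tow}(a,k,r)}$, non-integer heights rounded up. Logarithms base 2.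
   Formalization: The formal theorem assumes β ≥ 0 (β is a density threshold); for very negative β the tower height becomes zero or negative and the stated bound fails or is undefined, while n_p = 1 trivially for every β < 0. *)

(* Defs.v *)
From HB Require Import structures.
From mathcomp Require Import all_boot all_order all_algebra.
From Stdlib Require Import Reals.

Set Implicit Arguments.
Unset Strict Implicit.
Unset Printing Implicit Defensive.

Definition ap3_count (p n : nat) (A : {set 'rV['F_p]_n}) (d : 'rV['F_p]_n) : nat :=
  #|[set x : 'rV['F_p]_n | [&& x \in A, GRing.add x d \in A & GRing.add x (GRing.natmul d 2) \in A]]|.

Definition density (p n : nat) (A : {set 'rV['F_p]_n}) : R :=
  Rdiv (INR #|A|) (INR (expn p n)).

Definition ap3_density (p n : nat) (A : {set 'rV['F_p]_n}) (d : 'rV['F_p]_n) : R :=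
  Rdiv (INR (ap3_count A d)) (INR (expn p n)).

Definition np_prop (p : nat) (alpha beta : R) (N : nat) : Prop :=
  forall n : nat, (N <= n)%N ->
  forall A : {set 'rV['F_p]_n}, Rge (density A) alpha ->
  exists d : 'rV['F_p]_n, d != GRing.zero /\ Rge (ap3_density A d) beta.

Definition is_np (p : nat) (alpha beta : R) (N : nat) : Prop :=
  (0 < N)%N /\ np_prop p alpha beta N /\
  (forall M : nat, (0 < M)%N -> np_prop p alpha beta M -> (N <= M)%N).

Fixpoint Tow (a : R) (k : nat) (r : R) : R :=
  match k with
  | O => r
  | S k' => Rpower a (Tow a k' r)
  end.

(* ceiling of a real number: 1 - up(-x) ; heights rounded up, negatives clamped to 0 *)
Definition Rceil (x : R) : Z := (1 - up (Ropp x))%Z.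

Definition height (x : R) : nat := Z.to_nat (Rceil x).

Definition log2 (x : R) : R := Rdiv (ln x) (ln 2).

(* Main.v *)
Require Import Defs.
From HB Require Import structures.
From mathcomp Require Import all_boot all_order all_algebra.
From mathcomp Require Import ring lra zify complex.
From mathcomp Require Import boolp Rstruct.

(* Suppose that every nonzero difference is unpopular. For a subspace H let phi(H)
   be the variance of the densities, on the cosets of H, of the complement g of A,
   and let c <= gamma be the density of g. Averaging over the differences in H and
   expanding (1 - g)(1 - g)(1 - g) makes the 3-AP count of g inside the cosets
   of H exceed c^3 + 3 phi(H) + eps / 2. On the other hand, adding to H^perp all
   frequencies where some restriction of g to a coset of H has a large Fourier
   coefficient gives a subspace K, of codimension exponential in that of H, such
   that g may be replaced by its averages over the cosets of K. An elementary
   estimate bounds the resulting count by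
   c^3 + 9/4 phi(H) + 3 c (phi(K) - phi(H)), up to a small multiple of eps. Hence
   phi(K) is at least phi(H) / (4 gamma) plus a gain of order eps / gamma, and
   after log eps / log (36 gamma) steps the variance would exceed 1. Each step costs
   one exponential, and the nine additional levels of the tower absorb the
   dependence of the initial codimension on 1 / eps. In characteristic 2 the third
   point of a progression is the first one, and averaging over all differences
   suffices. *)

Set Implicit Arguments.
Unset Strict Implicit.
Unset Printing Implicit Defensive.

Import Order.TTheory GRing.Theory Num.Theory.

Local Open Scope ring_scope.

(** * Averages over subgroups *)

(** Conditional expectation on the cosets of [H], kept as a function on the whole space. *)
Definition avg (R : fieldType) (V : finZmodType) (H : {set V}) (f : V -> R) x : R :=
  (\sum_(t in H) f (x + t)) / #|H|%:R.

(** When [H] is a subgroup, these progressions stay inside single cosets of [H]. *)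
Definition ap3_sum (R : pzRingType) (V : finZmodType) (H : {set V})
    (a b c : V -> R) : R :=
  \sum_x \sum_(d in H) a x * b (x + d) * c (x + d *+ 2).

Section Shifts.
Variable V : finZmodType.
Implicit Types H : {set V}.

Lemma mem_addr_subgroup H x t :
  zmod_closed (mem H) -> t \in H -> (x + t \in H) = (x \in H).
Proof.
case=> H0 HB tH; apply/idP/idP => xH; first by rewrite -(addrK t x) HB.
by rewrite -[t]opprK HB // -sub0r HB.
Qed.

Lemma sum_shift_subgroup (A : nmodType) H (F : V -> A) s : zmod_closed (mem H) ->
  s \in H -> \sum_(t in H) F (t + s) = \sum_(t in H) F t.
Proof.
move=> zH sH; rewrite [RHS](reindex_inj (addIr s)) /=.
by apply: eq_bigl => t; rewrite mem_addr_subgroup.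
Qed.

Lemma sum_shift (A : nmodType) (F : V -> A) s : \sum_x F (x + s) = \sum_x F x.
Proof. by rewrite [RHS](reindex_inj (addIr s)). Qed.

End Shifts.

Section Averages.
Variables (R : realFieldType) (V : finZmodType).
Implicit Types (H K : {set V}) (f g : V -> R).

Lemma subgroup_card_gt0 H : zmod_closed (mem H) -> 0 < #|H|%:R :> R.
Proof. by case=> H0 _; rewrite ltr0n; apply/card_gt0P; exists 0. Qed.

Lemma sum_avgE H f x : zmod_closed (mem H) ->
  \sum_(t in H) f (x + t) = #|H|%:R * avg H f x.
Proof.
by move=> zH; rewrite /avg mulrC divfK // gt_eqF // subgroup_card_gt0.
Qed.

Lemma avg_shift H f x t : zmod_closed (mem H) -> t \in H ->
  avg H f (x + t) = avg H f x.
Proof.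
move=> zH tH; rewrite /avg; congr (_ / _).
rewrite -[RHS](sum_shift_subgroup (fun s => f (x + s)) zH tH).
by apply: eq_bigr => s _; rewrite -addrA [t + s]addrC.
Qed.

(** Averaging is self-adjoint: a translation by [t] in [H] leaves [m] fixed, and summing over all
    [t] turns [f] into its average. *)
Lemma sum_avg_mul H f m : zmod_closed (mem H) ->
  (forall x t, t \in H -> m (x + t) = m x) ->
  \sum_x f x * m x = \sum_x avg H f x * m x.
Proof.
move=> zH mH; have H0 := subgroup_card_gt0 zH.
apply: (mulfI (lt0r_neq0 H0)); rewrite !mulr_sumr.
under [RHS]eq_bigr do rewrite mulrA -sum_avgE // mulr_suml.
rewrite exchange_big /= -mulr_sumr -sumr_const mulr_suml.
apply: eq_bigr => t tH; rewrite mul1r -[LHS](sum_shift _ t).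
by apply: eq_bigr => x _; rewrite mH.
Qed.

Lemma sum_avg H f : zmod_closed (mem H) -> \sum_x avg H f x = \sum_x f x.
Proof.
move=> zH; have := @sum_avg_mul H f (fun=> 1) zH (fun _ _ _ => erefl).
by under eq_bigr do rewrite mulr1; under [in RHS]eq_bigr do rewrite mulr1.
Qed.

Lemma avg_avg H K f x : zmod_closed (mem H) -> zmod_closed (mem K) ->
  K \subset H -> avg H (avg K f) x = avg H f x.
Proof.
move=> zH zK sKH; rewrite {1}/avg [RHS]/avg; congr (_ / _).
apply: (mulfI (lt0r_neq0 (subgroup_card_gt0 zK))); rewrite mulr_sumr.
under eq_bigr do rewrite -sum_avgE //.
rewrite exchange_big /= -sumr_const mulr_suml; apply: eq_bigr => s sK.
rewrite mul1r -[RHS](sum_shift_subgroup _ zH (subsetP sKH _ sK)).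
by apply: eq_bigr => t _; rewrite addrA.
Qed.

Lemma avg_ge0 H f x : (forall y, 0 <= f y) -> 0 <= avg H f x.
Proof. by move=> f0; rewrite divr_ge0 // sumr_ge0. Qed.

Lemma avg_le H f x c : zmod_closed (mem H) ->
  (forall y, f y <= c) -> avg H f x <= c.
Proof.
move=> zH fc; rewrite ler_pdivrMr ?subgroup_card_gt0 // mulr_natr -sumr_const.
exact: ler_sum.
Qed.

(** Variance form of Cauchy-Schwarz: the difference is the mean of [(f - u) ^+ 2] on the coset. *)
Lemma sqr_avg_le H f x : zmod_closed (mem H) ->
  avg H f x ^+ 2 <= avg H (fun y => f y ^+ 2) x.
Proof.
move=> zH; have H0 := subgroup_card_gt0 zH; set u := avg H f x.
suff: 0 <= #|H|%:R * (avg H (fun y => f y ^+ 2) x - u ^+ 2).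
  by rewrite pmulr_rge0 // subr_ge0.
have -> : #|H|%:R * (avg H (fun y => f y ^+ 2) x - u ^+ 2)
        = \sum_(t in H) (f (x + t) - u) ^+ 2.
  have -> : \sum_(t in H) (f (x + t) - u) ^+ 2 = \sum_(t in H) f (x + t) ^+ 2
      - 2 * u * (\sum_(t in H) f (x + t)) + \sum_(t in H) u ^+ 2.
    rewrite mulr_sumr -sumrB -big_split /=; apply: eq_bigr => t _; ring.
  rewrite sumr_const -[u ^+ 2 *+ _]mulr_natl sum_avgE // -/u.
  rewrite (sum_avgE (fun y => f y ^+ 2)) //; ring.
by apply: sumr_ge0 => t _; exact: sqr_ge0.
Qed.

Lemma sum_avg_sqr H f : zmod_closed (mem H) ->
  \sum_x f x * avg H f x = \sum_x avg H f x ^+ 2.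
Proof.
move=> zH; rewrite (sum_avg_mul f zH) //; last by move=> *; rewrite avg_shift.
Qed.

Definition dbl_closed H := forall x : V, (x *+ 2 \in H) = (x \in H).

Lemma sum_dbl (A : nmodType) H (F : V -> A) : injective (fun x : V => x *+ 2) ->
  dbl_closed H -> \sum_(t in H) F (t *+ 2) = \sum_(t in H) F t.
Proof.
move=> inj2 H2; rewrite [RHS](reindex_inj inj2) /=.
by apply: eq_bigl => t; rewrite H2.
Qed.

(* AM-GM on the last two points bounds the inner sum by the average of
   [avg K f ^+ 2]; bounding the last point by 1 gives the other half of [min]. *)
Lemma ap3_sum_le H K f : zmod_closed (mem H) -> zmod_closed (mem K) ->
  K \subset H -> injective (fun x : V => x *+ 2) -> dbl_closed H ->
  (forall x, 0 <= f x <= 1) ->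
  ap3_sum H (avg K f) (avg K f) (avg K f) <= #|H|%:R *
    \sum_x avg H f x * Num.min (avg H f x) (avg H (fun y => avg K f y ^+ 2) x).
Proof.
move=> zH zK sKH inj2 H2 f01; set h := avg K f; set u := avg H f.
set q := avg H (fun y => h y ^+ 2).
have h0 x : 0 <= h x by apply: avg_ge0 => y; case/andP: (f01 y).
have h1 x : h x <= 1 by apply: avg_le => // y; case/andP: (f01 y).
have hu x : avg H h x = u x by exact: avg_avg.
have -> : \sum_x u x * Num.min (u x) (q x) = \sum_x h x * Num.min (u x) (q x).
  rewrite [RHS](sum_avg_mul h zH).
    by apply: eq_bigr => x _; rewrite hu.
  by move=> x t tH; rewrite /q /u !avg_shift.
rewrite mulr_sumr /ap3_sum; apply: ler_sum => x _.
have -> : \sum_(d in H) h x * h (x + d) * h (x + d *+ 2)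
        = h x * \sum_(d in H) h (x + d) * h (x + d *+ 2).
  by rewrite mulr_sumr; apply: eq_bigr => d _; rewrite mulrA.
rewrite mulrCA; apply: ler_wpM2l => //.
rewrite minEle; case: ifP => _.
  rewrite -hu -sum_avgE //; apply: ler_sum => d _.
  by rewrite ler_piMr.
rewrite -sum_avgE //.
have -> : \sum_(t in H) h (x + t) ^+ 2 =
   \sum_(t in H) (h (x + t) ^+ 2 + h (x + t *+ 2) ^+ 2) / 2.
  rewrite -mulr_suml big_split /= (sum_dbl (fun t => h (x + t) ^+ 2)) //.
  lra.
apply: ler_sum => d _; have := sqr_ge0 (h (x + d) - h (x + d *+ 2)).
by rewrite sqrrB; lra.
Qed.

(* The right-hand side is the tangent line at [c] of the cube plus quadratic
   errors; for [u > 3 * c] the factor 9 / 4 comes from [u <= 3 / 2 * (u - c)]. *)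
Lemma min_mul_le (c u q : R) : 0 <= c <= 60^-1 -> 0 <= u -> u ^+ 2 <= q ->
  u * Num.min u q <= c ^+ 3 + 3 * c ^+ 2 * (u - c) + 9 / 4 * (u - c) ^+ 2
                     + 3 * c * (q - u ^+ 2).
Proof.
move=> /andP[c0 c1] u0 uq; have [uc|uc] := lerP u (3 * c).
  have m : u * Num.min u q <= u * q by rewrite ler_wpM2l // ge_min lexx orbT.
  apply: le_trans m _.
  have e1 : 0 <= (3 * c - u) * (q - u ^+ 2) by rewrite mulr_ge0 ?subr_ge0.
  have e2 : 0 <= (9 / 4 - (u + 2 * c)) * (u - c) ^+ 2.
    by apply: mulr_ge0; [lra | exact: sqr_ge0].
  rewrite -subr_ge0; apply: le_trans (addr_ge0 e1 e2) _.
  rewrite le_eqVlt; apply/orP; left; apply/eqP; ring.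
have m : u * Num.min u q <= u * u by rewrite ler_wpM2l // ge_min lexx.
apply: le_trans m _.
have e1 : 0 <= 3 * c * (q - u ^+ 2) by rewrite mulr_ge0 ?subr_ge0 ?mulr_ge0.
have e2 : 0 <= c ^+ 3 + 3 * c ^+ 2 * (u - c).
  by rewrite addr_ge0 ?mulr_ge0 ?exprn_ge0 //; lra.
have e3 : u * u <= 9 / 4 * (u - c) ^+ 2.
  have : 0 <= (u - 3 * c) * (5 * u - 3 * c) by rewrite mulr_ge0 //; lra.
  lra.
lra.
Qed.

(** * Energy and progression counts *)

Definition energy H f : R := (\sum_x avg H f x ^+ 2) / #|V|%:R.

Lemma card_gt0 : 0 < #|V|%:R :> R.
Proof. by rewrite ltr0n; apply/card_gt0P; exists 0. Qed.

(** Sums [min_mul_le] over all [x]. The linear term vanishes because [u] has mean [c], and [q] has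
    mean [energy K f]. *)
Lemma ap3_sum_le_energy H K f c : zmod_closed (mem H) -> zmod_closed (mem K) ->
  K \subset H -> injective (fun x : V => x *+ 2) -> dbl_closed H ->
  (forall x, 0 <= f x <= 1) -> \sum_x f x = #|V|%:R * c -> c <= 60^-1 ->
  ap3_sum H (avg K f) (avg K f) (avg K f) <= #|H|%:R * #|V|%:R *
    (c ^+ 3 + 9 / 4 * (energy H f - c ^+ 2)
     + 3 * c * (energy K f - energy H f)).
Proof.
move=> zH zK sKH inj2 H2 f01 fc c1; set h := avg K f.
have V0 := card_gt0.
have c0 : 0 <= c.
  rewrite -(pmulr_rge0 _ V0) -fc sumr_ge0 // => x _; by case/andP: (f01 x).
apply: le_trans (ap3_sum_le zH zK sKH inj2 H2 f01) _.
rewrite -mulrA; apply: ler_wpM2l => //.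
pose u := avg H f; pose q := avg H (fun y => h y ^+ 2).
have hu x : avg H h x = u x by exact: avg_avg.
have step : \sum_x u x * Num.min (u x) (q x) <=
  \sum_x (c ^+ 3 + 3 * c ^+ 2 * (u x - c) + 9 / 4 * (u x - c) ^+ 2
                     + 3 * c * (q x - u x ^+ 2)).
  apply: ler_sum => x _; apply: min_mul_le; first by rewrite c0.
    by apply: avg_ge0 => y; case/andP: (f01 y).
  by rewrite -hu; apply: sqr_avg_le.
apply: le_trans step _.
have -> : \sum_x (c ^+ 3 + 3 * c ^+ 2 * (u x - c) + 9 / 4 * (u x - c) ^+ 2
                     + 3 * c * (q x - u x ^+ 2)) =
  \sum_(x : V) (c ^+ 3 - 3 * c ^+ 3 + 9 / 4 * c ^+ 2) +
  (3 * c ^+ 2 - 9 / 2 * c) * (\sum_x u x) + (9 / 4 - 3 * c) * (\sum_x u x ^+ 2)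
  + 3 * c * (\sum_x q x).
  rewrite !mulr_sumr -!big_split /=; apply: eq_bigr => x _; by field.
rewrite [\sum_x u x]sum_avg // [\sum_x q x]sum_avg // fc.
rewrite sumr_const -[_ *+ #|_|]mulr_natl.
have eE L : \sum_x avg L f x ^+ 2 = #|V|%:R * energy L f.
  by rewrite /energy mulrC divfK // lt0r_neq0.
rewrite /u /h !eE; lra.
Qed.

(** In the expanded product the three pair terms coincide, since doubling permutes [H] and
    translation permutes [V]; each contributes one copy of the energy. *)
Lemma ap3_sum_compl H f c : zmod_closed (mem H) ->
  injective (fun x : V => x *+ 2) -> dbl_closed H ->
  \sum_x f x = #|V|%:R * c ->
  let a x := 1 - f x in
  ap3_sum H a a a =
  #|H|%:R * #|V|%:R * (1 - 3 * c + 3 * energy H f) - ap3_sum H f f f.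
Proof.
move=> zH inj2 H2 fc a; have V0 := card_gt0.
have s1 y : \sum_x f (x + y) = #|V|%:R * c by rewrite sum_shift.
have E1 : \sum_x \sum_(d in H) f x * f (x + d) =
          #|H|%:R * (#|V|%:R * energy H f).
  rewrite /energy [#|V|%:R * _]mulrC divfK ?lt0r_neq0 // -sum_avg_sqr //.
  rewrite mulr_sumr; apply: eq_bigr => x _; rewrite -mulr_sumr.
  by rewrite sum_avgE // mulrCA.
have E2 : \sum_x \sum_(d in H) f x * f (x + d *+ 2) =
          \sum_x \sum_(d in H) f x * f (x + d).
  apply: eq_bigr => x _; exact: (sum_dbl (fun d => f x * f (x + d))).
have E3 : \sum_x \sum_(d in H) f (x + d) * f (x + d *+ 2) =
          \sum_x \sum_(d in H) f x * f (x + d).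
  rewrite exchange_big [RHS]exchange_big /=; apply: eq_bigr => d _.
  rewrite -(sum_shift (fun x => f x * f (x + d)) d).
  by apply: eq_bigr => x _; rewrite mulr2n addrA.
have S (F : V -> V -> R) y : (forall d, \sum_x F x d = y) ->
   \sum_x \sum_(d in H) F x d = #|H|%:R * y.
  move=> Fy; rewrite exchange_big /= (eq_bigr (fun=> y)) //.
  by rewrite sumr_const mulr_natl.
have -> : ap3_sum H a a a = \sum_(x : V) \sum_(d in H) 1
   - \sum_x \sum_(d in H) f x - \sum_x \sum_(d in H) f (x + d)
   - \sum_x \sum_(d in H) f (x + d *+ 2)
   + \sum_x \sum_(d in H) f x * f (x + d)
   + \sum_x \sum_(d in H) f x * f (x + d *+ 2)
   + \sum_x \sum_(d in H) f (x + d) * f (x + d *+ 2) - ap3_sum H f f f.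
  rewrite /ap3_sum -!sumrB -!big_split -sumrB; apply: eq_bigr => x _ /=.
  rewrite -!sumrB -!big_split -sumrB; apply: eq_bigr => d _ /=.
  by rewrite /a; ring.
have S1 : \sum_(x : V) 1 = #|V|%:R :> R by rewrite sumr_const.
rewrite E3 E2 E1 (S _ _ (fun=> S1)) (S _ _ (fun=> fc)).
by rewrite (S _ _ s1) (S _ _ (fun d => s1 (d *+ 2))); ring.
Qed.

End Averages.

(** * Fourier analysis *)

(** A root [z] of 1 + X + ... + X^(p-1) is a p-th root of unity, different from 1 because the
    polynomial takes the value p there; the character sends [a] to [z ^+ a]. *)
Lemma exists_additive_character (C : numClosedFieldType) (p : nat) : prime p ->
  exists psi : 'F_p -> C,
    [/\ {morph psi : a b / a + b >-> a * b}, forall a, `|psi a| = 1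
      & psi 1 != 1].
Proof.
move=> p_pr; have p1 := prime_gt1 p_pr.
have [z] : exists z : C, root (\poly_(i < p) 1) z.
  apply/closed_rootP; rewrite size_poly_eq ?oner_neq0 //.
  by rewrite neq_ltn p1 orbT.
rewrite /root horner_poly; under eq_bigr do rewrite mul1r.
move/eqP=> z0; have zp : z ^+ p = 1.
  by apply/eqP; rewrite -subr_eq0 subrX1 z0 mulr0.
have z1 : z != 1.
  apply: contra_eq_neq z0 => ->; under eq_bigr do rewrite expr1n.
  by rewrite sumr_const card_ord pnatr_eq0 -lt0n prime_gt0.
exists (fun a => z ^+ (a : nat)); split.
- move=> a b; rewrite -exprD -[RHS](expr_mod _ zp); congr (z ^+ _).
  by rewrite /= [X in (_ %% X)%N]Fp_cast.
- move=> a; rewrite normrX; suff -> : `|z| = 1 by rewrite expr1n.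
  apply/eqP; rewrite -(@pexpr_eq1 _ _ p) ?prime_gt0 //.
  by rewrite -normrX zp normr1.
- by rewrite /= expr1.
Qed.

Section Fourier.
Variables (C : numClosedFieldType) (p n : nat).
Local Notation V := 'rV['F_p]_n.
Variable psi : 'F_p -> C.
Hypothesis psiD : {morph psi : a b / a + b >-> a * b}.
Hypothesis psi_norm : forall a, `|psi a| = 1.
Hypothesis psi1 : psi 1 != 1.
Implicit Types (r x y : V) (f a b w : V -> C) (H K : {set V}).

Definition dot r x : 'F_p := \sum_i r 0 i * x 0 i.

Lemma dotDl r s x : dot (r + s) x = dot r x + dot s x.
Proof. by rewrite -big_split; apply: eq_bigr => i _; rewrite mxE mulrDl. Qed.

Lemma dotC r x : dot r x = dot x r.
Proof. by apply: eq_bigr => i _; rewrite mulrC. Qed.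

Lemma dotDr r x y : dot r (x + y) = dot r x + dot r y.
Proof. by rewrite dotC dotDl !(dotC r). Qed.

Lemma dot0 r : dot r 0 = 0.
Proof. by apply: big1 => i _; rewrite mxE mulr0. Qed.

Lemma dotN r x : dot r (- x) = - dot r x.
Proof. by apply: (addrI (dot r x)); rewrite -dotDr !subrr dot0. Qed.

Lemma dotMn r x k : dot r (x *+ k) = dot r x *+ k.
Proof. by elim: k => [|k IH]; rewrite ?dot0 // !mulrS dotDr IH. Qed.

Lemma psi0 : psi 0 = 1.
Proof.
have n0 : psi 0 != 0 by rewrite -normr_eq0 psi_norm oner_neq0.
by apply: (mulfI n0); rewrite -psiD addr0 mulr1.
Qed.

Lemma psiN (t : 'F_p) : psi (- t) = (psi t)^*.
Proof.
have n0 : psi t != 0 by rewrite -normr_eq0 psi_norm oner_neq0.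
by apply: (mulfI n0); rewrite -psiD subrr psi0 -normCK psi_norm expr1n.
Qed.

(** Translation by [s] in [H] multiplies the sum by [psi (dot r s)], so a single value other than 1
    forces the sum to vanish. *)
Lemma subgroup_character_sum H r : zmod_closed (mem H) ->
  (\sum_(t in H) psi (dot r t) == if [forall t in H, psi (dot r t) == 1]
                                   then #|H|%:R else 0).
Proof.
move=> zH; case: ifPn => [/forall_inP h|].
  by rewrite (eq_bigr (fun=> 1)) => [|t /h /eqP //]; rewrite sumr_const.
rewrite negb_forall_in => /exists_inP[s sH ns].
set S := \sum_(t in H) _; have e : S = S * psi (dot r s).
  rewrite -[LHS](sum_shift_subgroup _ zH sH) mulr_suml.
  by apply: eq_bigr => t _; rewrite dotDr psiD.
have : S * (psi (dot r s) - 1) == 0 by rewrite mulrBr -e mulr1 subrr.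
by rewrite mulf_eq0 subr_eq0 (negPf ns) orbF.
Qed.

Lemma character_sum x : \sum_r psi (dot r x) = #|{: V}|%:R *+ (x == 0).
Proof.
have zT : zmod_closed (mem [set: V]).
  by split=> [|u v _ _]; exact: in_setT.
under eq_bigr do rewrite dotC.
transitivity (\sum_(t in [set: V]) psi (dot x t)).
  by apply: eq_bigl => t; rewrite inE.
rewrite (eqP (subgroup_character_sum x zT)) cardsT.
have [->|nx] := eqVneq x 0.
  case: ifP => //; case/negP; apply/forall_inP => t _.
  by rewrite dotC dot0 psi0.
case: ifP => // /forall_inP h; case/negP: psi1.
have [i xi] : exists i, x 0 i != 0.
  apply/existsP; apply: contraNT nx; rewrite negb_exists => /forallP x0.
  by apply/eqP/rowP => i; rewrite mxE; apply/eqP/negPn.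
(* The test vector has product 1 with [x], so triviality of the character on it contradicts
   [psi1]. *)
have := h (\row_j ((x 0 i)^-1 *+ (j == i))) (in_setT _).
rewrite /dot (bigD1 i) //= mxE eqxx mulfV // big1 ?addr0 // => j ji.
by rewrite mxE (negPf ji) mulr0.
Qed.

Definition fourier f r : C := \sum_x f x * psi (dot r x).

Lemma parseval f : \sum_r `|fourier f r| ^+ 2 = #|{: V}|%:R * \sum_x `|f x| ^+ 2.
Proof.
have -> : \sum_r `|fourier f r| ^+ 2 =
   \sum_r \sum_x \sum_y f x * (f y)^* * psi (dot r (x - y)).
  apply: eq_bigr => r _; rewrite normCK rmorph_sum big_distrlr /=.
  apply: eq_bigr => x _; apply: eq_bigr => y _.
  by rewrite rmorphM dotDr dotN psiD psiN mulrACA.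
rewrite exchange_big mulr_sumr /=; apply: eq_bigr => x _.
rewrite exchange_big (bigD1 x) //= -mulr_sumr character_sum subrr eqxx.
rewrite big1 ?addr0 => [|y yx]; first by rewrite normCK mulrC.
by rewrite -mulr_sumr character_sum subr_eq0 eq_sym (negPf yx) mulr0.
Qed.

(** Points [x], [y], [z] form a progression exactly when [x - y *+ 2 + z] is 0, and orthogonality of
    characters detects this relation. *)
Lemma ap3_sum_fourier a b w : #|{: V}|%:R * ap3_sum [set: V] a b w =
  \sum_r fourier a r * fourier b (- r *+ 2) * fourier w r.
Proof.
have -> : \sum_r fourier a r * fourier b (- r *+ 2) * fourier w r =
  \sum_r \sum_x \sum_y \sum_z a x * b y * w z * psi (dot r (x - y *+ 2 + z)).
  apply: eq_bigr => r _; rewrite /fourier big_distrlr mulr_suml /=.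
  apply: eq_bigr => x _; rewrite mulr_suml; apply: eq_bigr => y _.
  rewrite mulr_sumr; apply: eq_bigr => z _.
  have -> : dot (- r *+ 2) y = dot r (- (y *+ 2)).
    by rewrite dotC dotMn !dotN dotMn mulNrn dotC.
  by rewrite !dotDr !psiD; ring.
rewrite exchange_big mulr_sumr /=; apply: eq_bigr => x _.
rewrite exchange_big mulr_sumr /= [RHS](reindex_inj (addrI x)).
rewrite (eq_bigl predT) => [|d]; last by rewrite inE.
apply: eq_bigr => d _.
rewrite exchange_big (bigD1 (x + d *+ 2)) //= -mulr_sumr character_sum.
have e z : (x - (x + d) *+ 2 + z == 0) = (z == x + d *+ 2).
  rewrite mulrnDl [x *+ 2]mulr2n -[x + x + _]addrA opprD addrA subrr add0r.
  by rewrite [- _ + z]addrC subr_eq0.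
rewrite e eqxx big1 ?addr0 => [|z zx]; first by rewrite mulrC.
by rewrite -mulr_sumr character_sum e (negPf zx) mulr0.
Qed.

(** A supremum bound on one factor and AM-GM on the other two. *)
Lemma norm_sum_mul3_le (I : finType) (A B W : I -> C) M E : 0 <= M ->
  (forall i, `|A i| <= M) -> \sum_i `|B i| ^+ 2 <= E -> \sum_i `|W i| ^+ 2 <= E ->
  `|\sum_i A i * B i * W i| <= M * E.
Proof.
move=> M0 AM BE WE; apply: le_trans (ler_norm_sum _ _ _) _.
apply: (@le_trans _ _ (\sum_i M * ((`|B i| ^+ 2 + `|W i| ^+ 2) / 2))).
  apply: ler_sum => i _; rewrite -mulrA !normrM.
  apply: ler_pM; rewrite ?mulr_ge0 //.
  exact: (real_leif_mean_square (normr_real (B i)) (normr_real (W i))).1.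
rewrite -mulr_sumr ler_wpM2l // -mulr_suml big_split /= ler_pdivrMr ?ltr0n //.
by rewrite mulr_natr mulr2n lerD.
Qed.

(* Every coset of [H] is counted #|H| times, once for each [y] in it, so that
   sums over cosets become sums over the whole space. *)
Definition loc H y f x := f x *+ (x - y \in H).

(** A progression with difference in [H] survives localisation exactly for the [y] in its own
    coset. *)
Lemma ap3_sum_loc H a b w : zmod_closed (mem H) ->
  #|H|%:R * ap3_sum H a b w =
  \sum_y ap3_sum [set: V] (loc H y a) (loc H y b) (loc H y w).
Proof.
move=> zH; rewrite /ap3_sum [RHS]exchange_big mulr_sumr /=; apply: eq_bigr => x _.
rewrite [RHS]exchange_big mulr_sumr big_mkcond /=.
rewrite [RHS](eq_bigl predT) => [|d]; last by rewrite inE.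
apply: eq_bigr => d _; set t := a x * b (x + d) * w (x + d *+ 2).
have locE y : loc H y a x * loc H y b (x + d) * loc H y w (x + d *+ 2) =
    if d \in H then t *+ (x - y \in H) else 0.
  rewrite /loc ![x + _ - y]addrAC; case: (boolP (x - y \in H)) => xy; last first.
    by rewrite mulr0n !mul0r if_same.
  have xyD u : (x - y + u \in H) = (u \in H) by rewrite addrC mem_addr_subgroup.
  rewrite !xyD; case: ifP => dH; last by rewrite mulr0n mulr0 mul0r.
  by rewrite mulr2n mem_addr_subgroup // dH.
under [RHS]eq_bigr do rewrite locE.
case: ifP => dH; last by rewrite big1.
rewrite sumrMnr [LHS]mulr_natl; congr (_ *+ _).
rewrite -sum1_card big_mkcond /= [LHS](reindex_inj (@subrI _ x)).
by apply: eq_bigr => y _; case: ifP.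
Qed.

Lemma loc_sqr_sum_le H y f : (forall x, `|f x| <= 1) ->
  \sum_x `|loc H y f x| ^+ 2 <= #|H|%:R.
Proof.
move=> f1; rewrite (reindex_inj (addIr y)) -sum1_card natr_sum [leRHS]big_mkcond /=.
apply: ler_sum => x _; rewrite /loc addrK; case: ifP => _.
  by rewrite mulr1n exprn_ile1.
by rewrite mulr0n normr0 expr0n.
Qed.

Definition fourier_small H M f := forall y r, `|fourier (loc H y f) r| <= M.

Hypothesis inj2 : injective (fun x : V => x *+ 2).

Lemma fourier_dbl_sqr_sum f :
  \sum_r `|fourier f (- r *+ 2)| ^+ 2 = #|{: V}|%:R * \sum_x `|f x| ^+ 2.
Proof.
rewrite -parseval [RHS](reindex_inj (inj_comp inj2 (@oppr_inj _))).
by [].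
Qed.

(** On each coset the supremum bound controls the transform of [v], in whichever position it stands,
    and Parseval controls the other two. Injectivity of doubling makes Parseval available at
    [- r *+ 2]. *)
Lemma ap3_sum_small H M v b w : zmod_closed (mem H) -> 0 <= M ->
  fourier_small H M v -> (forall x, `|b x| <= 1) -> (forall x, `|w x| <= 1) ->
  [/\ `|ap3_sum H v b w| <= #|{: V}|%:R * M,
      `|ap3_sum H b v w| <= #|{: V}|%:R * M
    & `|ap3_sum H b w v| <= #|{: V}|%:R * M].
Proof.
move=> zH M0 vM b1 w1.
have [H0 N0] : 0 < #|H|%:R :> C /\ 0 < #|{: V}|%:R :> C.
  split; rewrite ltr0n; apply/card_gt0P; exists 0 => //; exact: zH.1.
pose E : C := #|{: V}|%:R * #|H|%:R.
have from_fourier a c d :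
    (forall y, `|\sum_r fourier (loc H y a) r * fourier (loc H y c) (- r *+ 2) *
                      fourier (loc H y d) r| <= M * E) ->
    `|ap3_sum H a c d| <= #|{: V}|%:R * M.
  move=> h; rewrite -(ler_pM2l H0) -{1}[#|H|%:R]ger0_norm ?ler0n // -normrM.
  rewrite ap3_sum_loc // -(ler_pM2l N0) -{1}[#|{: V}|%:R]ger0_norm ?ler0n //.
  rewrite -normrM mulr_sumr; apply: le_trans (ler_norm_sum _ _ _) _.
  apply: (@le_trans _ _ (\sum_(y : V) M * E)).
    by apply: ler_sum => y _; rewrite ap3_sum_fourier.
  rewrite sumr_const -[leLHS]mulr_natl ler_wpM2l ?ler0n //.
  by rewrite /E mulrCA mulrA mulrC mulrA.
have e1 f y : (forall x, `|f x| <= 1) ->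
    \sum_r `|fourier (loc H y f) r| ^+ 2 <= E.
  by move=> f1; rewrite parseval ler_wpM2l // loc_sqr_sum_le.
have e2 f y : (forall x, `|f x| <= 1) ->
    \sum_r `|fourier (loc H y f) (- r *+ 2)| ^+ 2 <= E.
  by move=> f1; rewrite fourier_dbl_sqr_sum ler_wpM2l // loc_sqr_sum_le.
split; apply: from_fourier => y.
- by apply: norm_sum_mul3_le; auto.
- under eq_bigr do rewrite [fourier _ _ * _]mulrC.
  by apply: norm_sum_mul3_le; auto => r; apply: vM.
- under eq_bigr do rewrite mulrC mulrA.
  by apply: norm_sum_mul3_le; auto.
Qed.

(** Telescoping replaces [g] by [h] one position at a time, hence the factor 3. *)
Lemma ap3_sum_diff H M g h : zmod_closed (mem H) -> 0 <= M ->
  (forall x, `|g x| <= 1) -> (forall x, `|h x| <= 1) ->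
  fourier_small H M (fun x => g x - h x) ->
  `|ap3_sum H g g g - ap3_sum H h h h| <= 3 * (#|{: V}|%:R * M).
Proof.
move=> zH M0 g1 h1; set v := fun x => g x - h x => vM.
have -> : ap3_sum H g g g - ap3_sum H h h h =
    ap3_sum H v g g + ap3_sum H h v g + ap3_sum H h h v.
  rewrite /ap3_sum -!big_split -sumrB; apply: eq_bigr => x _ /=.
  rewrite -!big_split -sumrB; apply: eq_bigr => d _ /=; rewrite /v; ring.
have [p1 _ _] := ap3_sum_small zH M0 vM g1 g1.
have [_ p2 _] := ap3_sum_small zH M0 vM h1 g1.
have [_ _ p3] := ap3_sum_small zH M0 vM h1 h1.
have -> X : 3 * X = X + X + X :> C by ring.
apply: le_trans (ler_normD _ _) _; apply: lerD => //.
by apply: le_trans (ler_normD _ _) _; apply: lerD.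
Qed.

(** * Annihilators and large spectra *)

Definition annihilator (S : seq V) : {set V} := [set d | all (fun s => dot s d == 0) S].

Lemma annihilator_zmod S : zmod_closed (mem (annihilator S)).
Proof.
split=> [|u v]; first by rewrite inE; apply/allP => s _; rewrite dot0.
rewrite !inE => /allP hu /allP hv; apply/allP => s sS.
by rewrite dotDr dotN (eqP (hu s sS)) (eqP (hv s sS)) subr0.
Qed.

(** Each fibre of the evaluation map [F] is empty or has a translate inside the annihilator. *)
Lemma card_annihilator S : prime p -> (#|{: V}| <= p ^ size S * #|annihilator S|)%N.
Proof.
pose F (x : V) := [tuple of map (fun s => dot s x) (in_tuple S)].
move=> p_pr; rewrite -[X in (X <= _)%N]sum1_card (partition_big F predT) //=.
have -> : (p ^ size S = #|{: (size S).-tuple 'F_p}|)%N.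
  by rewrite card_tuple card_Fp.
rewrite -sum_nat_const; apply: leq_sum => w _.
rewrite sum1dep_card; have [->|[x0]] := set_0Vmem [set x | F x == w].
  by rewrite cards0.
rewrite inE => /eqP Fx0; rewrite -(card_imset _ (addIr (- x0))).
apply/subset_leq_card/subsetP => y /imsetP[x]; rewrite inE -Fx0 => /eqP Fx ->.
rewrite inE; apply/allP => s sS; rewrite dotDr dotN subr_eq0.
have /(congr1 (fun t : seq _ => nth 0 t (index s S))) := congr1 val Fx.
by rewrite /= !(nth_map 0) ?index_mem // nth_index // => ->.
Qed.

(** Averaging over [K] is a convolution, so it multiplies the transform by a normalised character
    sum, which is 0 or 1. It commutes with [loc] because [K] lies in [H]. *)
Lemma fourier_avg K H y f r : zmod_closed (mem H) -> zmod_closed (mem K) ->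
  K \subset H ->
  fourier (loc H y (avg K f)) r = fourier (loc H y f) r *
     ((\sum_(t in K) psi (dot (- r) t)) / #|K|%:R).
Proof.
move=> zH zK sKH; rewrite mulrA; apply: (canRL (mulfK _)).
  by rewrite pnatr_eq0 -lt0n; apply/card_gt0P; exists 0; exact: zK.1.
rewrite /fourier big_distrl big_distrlr /= exchange_big /=.
have e x : loc H y (avg K f) x * psi (dot r x) * #|K|%:R =
    \sum_(t in K) loc H y f (x + t) * psi (dot r (x + t)) * psi (dot (- r) t).
  rewrite {1}/loc mulrAC; have [xH|xH] := boolP (x - y \in H); last first.
    rewrite mulr0n !mul0r big1 // => t tK; rewrite /loc addrAC.
    have tH := subsetP sKH _ tK.
    by rewrite mem_addr_subgroup // (negPf xH) mulr0n !mul0r.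
  rewrite mulr1n /avg divfK; last first.
    by rewrite pnatr_eq0 -lt0n; apply/card_gt0P; exists 0; exact: zK.1.
  rewrite mulr_suml; apply: eq_bigr => t tK; rewrite /loc addrAC.
  have tH := subsetP sKH _ tK.
  rewrite mem_addr_subgroup // xH mulr1n -mulrA -psiD.
  by rewrite dotDr dotC [dot (- r) t]dotC dotN -addrA [dot t r]dotC subrr addr0 dotC.
rewrite (eq_bigr _ (fun x _ => e x)) exchange_big; apply: eq_bigr => t tK /=.
by rewrite (sum_shift (fun x => loc H y f x * psi (dot r x) * psi (dot (- r) t))).
Qed.

Definition large_spectrum H M f : {set V} :=
  [set r | [exists y, M <= `|fourier (loc H y f) r|]].

(** Parseval is summed over all [y]. A large frequency counts at least #|H| times, because
    [loc H y f] depends only on the coset of [y]. *)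
Lemma card_large_spectrum H M f : zmod_closed (mem H) -> 0 <= M ->
  (forall x, `|f x| <= 1) ->
  #|large_spectrum H M f|%:R * M ^+ 2 <= #|{: V}|%:R ^+ 2 :> C.
Proof.
move=> zH M0 f1; have H0 : 0 < #|H|%:R :> C.
  by rewrite ltr0n; apply/card_gt0P; exists 0; exact: zH.1.
rewrite -(ler_pM2l H0).
apply: (@le_trans _ _ (\sum_r \sum_y `|fourier (loc H y f) r| ^+ 2)).
  rewrite mulrCA [leLHS]mulr_natl -sumr_const big_mkcond /=.
  apply: ler_sum => r _; case: ifP => [|_]; last first.
    by apply: sumr_ge0 => y _; rewrite exprn_ge0.
  rewrite inE => /existsP[y0 My0].
  rewrite -(sum_shift _ y0) mulr_natl -sumr_const big_mkcond /=.
  apply: ler_sum => t _; case: ifP => tH; last by rewrite exprn_ge0.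
  have -> : fourier (loc H (t + y0) f) r = fourier (loc H y0 f) r.
    apply: eq_bigr => x _; rewrite /loc; congr (_ *+ (nat_of_bool _) * _).
    by rewrite -(mem_addr_subgroup _ zH tH) opprD addrA addrAC subrK.
  by rewrite lerXn2r ?nnegrE.
rewrite exchange_big; apply: (@le_trans _ _ (\sum_(y : V) #|{: V}|%:R * #|H|%:R)).
  by apply: ler_sum => y _; rewrite parseval ler_wpM2l // loc_sqr_sum_le.
by rewrite sumr_const -[leLHS]mulr_natl mulrA -expr2 mulrC.
Qed.

(** If the character of [r] is trivial on [K], then [f] and [avg K f] have equal coefficients at
    [r]. Otherwise averaging kills the coefficient, and [r] lies outside the large spectrum, whose
    members are orthogonal to [K]. *)
Lemma fourier_small_annihilator S M f : 0 <= M ->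
  let H := annihilator S in
  let K := annihilator (S ++ enum (large_spectrum H M f)) in
  fourier_small H M (fun x => f x - avg K f x).
Proof.
move=> M0 H K y r.
have [zH zK] : zmod_closed (mem H) /\ zmod_closed (mem K).
  by split; exact: annihilator_zmod.
have sKH : K \subset H.
  by apply/subsetP => x; rewrite !inE all_cat => /andP[].
have -> : fourier (loc H y (fun x => f x - avg K f x)) r =
   fourier (loc H y f) r - fourier (loc H y (avg K f)) r.
  by rewrite -sumrB; apply: eq_bigr => x _; rewrite -mulrBl -mulrnBl.
have K0 : #|K|%:R != 0 :> C.
  by rewrite pnatr_eq0 -lt0n; apply/card_gt0P; exists 0; exact: zK.1.
rewrite fourier_avg // (eqP (subgroup_character_sum (- r) zK)).
case: ifPn => h; first by rewrite divff // mulr1 subrr normr0.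
rewrite mul0r mulr0 subr0.
have [|] := boolP (r \in large_spectrum H M f) => [rL|].
  case/negP: h; apply/forall_inP => t; rewrite inE all_cat => /andP[_ /allP].
  move=> /(_ r); rewrite mem_enum => /(_ rL) /eqP rt.
  by rewrite dotC dotN dotC rt oppr0 psi0.
rewrite inE negb_exists => /forallP/(_ y).
by rewrite -real_ltNge ?ger0_real // => /ltW.
Qed.

End Fourier.

(** * Energy increment *)

Lemma natFp_neq0 p k : prime p -> (0 < k < p)%N -> k%:R != 0 :> 'F_p.
Proof.
move=> p_pr /andP[k0 kp]; rewrite -val_eqE /= val_Fp_nat ?prime_gt1 //.
by rewrite modn_small // -lt0n.
Qed.

Section Refinement.
Variables (R : rcfType) (p n : nat).
Hypothesis p_pr : prime p.
Hypothesis p_odd : (2 < p)%N.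
Local Notation V := 'rV['F_p]_n.
Local Notation N := (#|{: V}|%:R : R).
Implicit Types (S : seq V) (g : V -> R).

Lemma two_neq0 : 2 != 0 :> 'F_p.
Proof. exact: natFp_neq0. Qed.

Lemma dbl_inj : injective (fun x : V => x *+ 2).
Proof.
move=> x y /rowP xy; apply/rowP => i; have := xy i; rewrite !mulr2n !mxE.
rewrite -!mulr2n -[x _ _ *+ 2]mulr_natl -[y _ _ *+ 2]mulr_natl.
by move=> /(mulfI two_neq0).
Qed.

Lemma annihilator_dbl S : dbl_closed (annihilator S).
Proof.
move=> x; rewrite !inE; apply: eq_all => s; rewrite dotMn.
rewrite -[dot _ _ *+ 2]mulr_natl mulf_eq0.
by rewrite (negPf two_neq0).
Qed.

Lemma regular_refinement S g (delta : R) :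
  (forall x, 0 <= g x <= 1) -> 0 < delta ->
  exists S', let H := annihilator S in let K := annihilator S' in
    [/\ (size S')%:R <= (size S)%:R + (p ^ (2 * size S))%:R / delta ^+ 2,
        K \subset H
      & `|ap3_sum H g g g - ap3_sum H (avg K g) (avg K g) (avg K g)|
          <= 3 * (N * (delta * #|H|%:R))].
Proof.
move=> g01 d0; have [psi [psiD psi_norm psi1]] := exists_additive_character (R[i])%C p_pr.
pose C := (R[i])%C; pose io : R -> C := real_complex R.
pose f := io \o g; set H := annihilator S.
have zH : zmod_closed (mem H) by exact: annihilator_zmod.
have H0 : 0 < #|H|%:R :> R by exact: subgroup_card_gt0.
pose M : R := delta * #|H|%:R; have M0 : 0 <= M by rewrite mulr_ge0 // ltW.
have ioM0 : 0 <= io M by rewrite ler0c.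
pose L := large_spectrum psi H (io M) f.
have io1 (t : R) : 0 <= t <= 1 -> `|io t| <= 1.
  by move=> /andP[t0 t1]; rewrite ger0_norm ?ler0c // -(rmorph1 io) lecR.
have f1 x : `|f x| <= 1 by exact: io1.
exists (S ++ enum L) => K0 K; split.
- rewrite size_cat natrD lerD2l -cardE ler_pdivlMr ?exprn_gt0 //.
  have h := card_large_spectrum psiD psi_norm psi1 zH ioM0 f1.
  have {}h : #|L|%:R * M ^+ 2 <= N ^+ 2.
    by rewrite -lecR rmorphM !rmorphXn !rmorph_nat.
  have NH : N <= (p ^ size S)%:R * #|H|%:R.
    by rewrite -natrM ler_nat; exact: card_annihilator.
  rewrite -(ler_pM2r (exprn_gt0 2 H0)) -mulrA -exprMn; apply: le_trans h _.
  by rewrite mulnC expnM natrX -exprMn lerXn2r ?nnegrE // mulr_ge0.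
- by apply/subsetP => x; rewrite !inE all_cat => /andP[].
- have zK : zmod_closed (mem K) by exact: annihilator_zmod.
  have fs := fourier_small_annihilator psiD psi_norm S f ioM0.
  have avgE x : avg K f x = io (avg K g x).
    by rewrite /avg /io rmorphM fmorphV rmorph_nat rmorph_sum.
  have apE (q : V -> R) : ap3_sum H (io \o q) (io \o q) (io \o q) = io (ap3_sum H q q q).
    rewrite /ap3_sum /io rmorph_sum; apply: eq_bigr => x _.
    by rewrite rmorph_sum; apply: eq_bigr => d _; rewrite !rmorphM.
  have ionorm (t : R) : `|io t| = io `|t|.
    have [t0|t0] := ger0P t; first by rewrite ger0_norm // ler0c.
    by rewrite ltr0_norm /io ?rmorphN // -(rmorph0 (real_complex R)) ltcR.
  have h1 x : `|(io \o avg K g) x| <= 1.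
    apply: io1; rewrite avg_ge0 => [|y]; last by case/andP: (g01 y).
    by rewrite avg_le // => y; case/andP: (g01 y).
  suff: io `|ap3_sum H g g g - ap3_sum H (avg K g) (avg K g) (avg K g)|
        <= io (3 * (N * M)) by rewrite lecR.
  have ioB (t u : R) : io (t - u) = io t - io u by rewrite /io rmorphB.
  rewrite -ionorm ioB -!apE.
  have -> : io (3 * (N * M)) = 3 * (#|{: V}|%:R * io M).
    by rewrite /io !rmorphM !rmorph_nat.
  apply: (ap3_sum_diff psiD psi_norm psi1 dbl_inj zH ioM0 f1 h1).
  move=> y r; have := fs y r; rewrite -/H -/L -/K.
  by congr (`| _ | <= _); apply: eq_bigr => x _; rewrite /loc avgE.
Qed.

Definition compl_ind (A : {set V}) (x : V) : R := (x \notin A)%:R.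

(* [c] stands for the density of the complement of [A], which makes this the
   variance of the coset averages. *)
Definition energy_excess (A : {set V}) (c : R) S : R :=
  energy (annihilator S) (compl_ind A) - c ^+ 2.

Section Increment.
Variable A : {set V}.
Variables (c beta eps : R).
Local Notation g := (compl_ind A).
Local Notation phi := (energy_excess A c).
Hypothesis gc : \sum_x g x = N * c.
Hypothesis c_le : c <= 60^-1.
Hypothesis beta0 : 0 <= beta.
Hypothesis beta_le : beta <= (1 - c) ^+ 3 - eps.
Hypothesis eps0 : 0 < eps.

Lemma compl_ind01 x : 0 <= g x <= 1.
Proof. by rewrite /compl_ind; case: (x \notin A); rewrite ?lexx ?ler01. Qed.

Lemma ap3_sum_count (H : {set V}) :
  ap3_sum H (fun x => 1 - g x) (fun x => 1 - g x) (fun x => 1 - g x) =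
  \sum_(d in H) (ap3_count A d)%:R.
Proof.
rewrite /ap3_sum exchange_big; apply: eq_bigr => d _ /=.
rewrite /ap3_count -sum1_card natr_sum [RHS]big_mkcond /=; apply: eq_bigr => x _.
rewrite inE /compl_ind; case: (x \in A); case: (x + d \in A);
  case: (x + d *+ 2 \in A) => /=.
all: by rewrite ?subr0 ?subrr ?mul0r ?mulr0 ?mulr1.
Qed.

(** The margin [eps] is split: the difference 0 costs [eps / 2], the passage to [avg K g] costs
    [eps / 4], and [eps / 4] remains. The coefficients 3 and 9 / 4 of [phi S] in the lower and upper
    bounds leave 3 / 4. *)
Lemma energy_increment S :
  2 <= eps * #|annihilator S|%:R ->
  (forall d, d != 0 -> (ap3_count A d)%:R <= beta * N) ->
  exists2 S' : seq V,
    (size S')%:R <= (size S)%:R + (p ^ (2 * size S))%:R * (144 / eps ^+ 2)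
    & 3 / 4 * phi S + 3 * c * phi S + eps / 4 <= 3 * c * phi S'.
Proof.
(* With [delta = eps / 12] the error [3 * delta] is [eps / 4], and its inverse square gives
   [144 / eps ^+ 2]. *)
move=> epsH few; have d0 : 0 < eps / 12 by rewrite divr_gt0 ?ltr0n.
have [S' [szS' sKH diff]] := regular_refinement S compl_ind01 d0.
exists S'.
  move: szS'; rewrite expr_div_n invf_div -[12 ^+ 2]natrX //.
set H := annihilator S in epsH sKH diff *; set K := annihilator S' in sKH diff *.
have zH : zmod_closed (mem H) by exact: annihilator_zmod.
have zK : zmod_closed (mem K) by exact: annihilator_zmod.
have H0 : 0 < #|H|%:R :> R by exact: subgroup_card_gt0.
have N0 : 0 < N by exact: card_gt0.
have HN0 : 0 < #|H|%:R * N by rewrite mulr_gt0.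
have e1 := ap3_sum_compl zH dbl_inj (annihilator_dbl S) gc.
have e2 := ap3_sum_le_energy zH zK sKH dbl_inj (annihilator_dbl S) compl_ind01 gc c_le.
have e3 : \sum_(d in H) (ap3_count A d)%:R <= N + #|H|%:R * (beta * N).
  rewrite (bigD1 0) /=; last exact: zH.1.
  apply: lerD; first by rewrite ler_nat max_card.
  rewrite mulr_natl -sumr_const [leRHS](bigD1 0) /=; last exact: zH.1.
  apply: ler_wpDl; first by rewrite mulr_ge0.
  by apply: ler_sum => d /andP[_ /few].
move: e1; rewrite /= ap3_sum_count => e1.
have e4 := le_trans (ler_norm _) diff.
have e5 : N * 2 <= N * (eps * #|H|%:R) by rewrite ler_wpM2l // ltW.
rewrite /energy_excess -/H -/K -(ler_pM2l HN0).
have e6 : #|H|%:R * N * beta <= #|H|%:R * N * ((1 - c) ^+ 3 - eps).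
  by rewrite ler_wpM2l // ltW.
lra.
Qed.

Lemma energy_excess_ge0 S : 0 <= phi S.
Proof.
have N0 : 0 < N by exact: card_gt0.
have zH := annihilator_zmod S; set H := annihilator S in zH.
have : 0 <= \sum_x (avg H g x - c) ^+ 2 by apply: sumr_ge0 => x _; exact: sqr_ge0.
have -> : \sum_x (avg H g x - c) ^+ 2 = N * phi S.
  under eq_bigr do rewrite sqrrB.
  rewrite big_split sumrB /= sumr_const -[_ *+ #|_|]mulr_natl.
  under [X in _ - X + _]eq_bigr do rewrite -mulr_natr -mulrA.
  rewrite -mulr_suml sum_avg // gc /energy_excess /energy mulrBr.
  rewrite [N * (_ / _)]mulrC divfK ?lt0r_neq0 //.
  ring.
by rewrite pmulr_rge0.
Qed.

Lemma energy_excess_le1 S : phi S <= 1.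
Proof.
have N0 : 0 < N by exact: card_gt0.
have zH := annihilator_zmod S; rewrite /energy_excess lerBlDr.
apply: ler_wpDr; first exact: sqr_ge0.
rewrite /energy ler_pdivrMr // mul1r -[leRHS]sumr_const; apply: ler_sum => x _.
rewrite exprn_ile1 ?avg_ge0 ?avg_le // => y; by case/andP: (compl_ind01 y).
Qed.

Lemma density_ge0 : 0 <= c.
Proof.
rewrite -(pmulr_rge0 _ (card_gt0 R V)) -gc.
by apply: sumr_ge0 => x _; case/andP: (compl_ind01 x).
Qed.

(** Each increment shows that [phi S + eps / 4] is at most [4 * gamma] times its next value. The
    invariant carries [2 * size S] because that is the exponent in the next codimension bound, and
    [s] because [p ^ s] absorbs [288 / eps ^+ 2]. *)
Lemma energy_iteration gamma (s m : nat) : c <= gamma ->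
  (forall d, d != 0 -> (ap3_count A d)%:R <= beta * N) ->
  eps <= 1 -> 2 + 288 / eps ^+ 2 + s%:R <= (p ^ s)%:R ->
  (iter m (expn p) s <= n)%N ->
  exists2 S, (2 * size S + s <= iter m (expn p) s)%N
    & eps / 4 <= (4 * gamma) ^+ m * (phi S + eps / 4).
Proof.
move=> cg few eps1 sbig; elim: m => [|m IH] mn.
  by exists [::]; rewrite ?muln0 // expr0 mul1r ler_wpDl ?energy_excess_ge0.
have p1 := prime_gt1 p_pr.
have cm : (iter m (expn p) s < n)%N by apply: leq_trans mn; rewrite iterS ltn_expl.
have c0 := density_ge0.
have [S szS hS] := IH (ltnW cm).
(* The annihilator has at least [p ^ (n - size S)] elements, and [size S + s <= n]. *)
have ps : (p ^ s)%:R <= #|annihilator S|%:R :> R.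
  rewrite ler_nat -(@leq_pmul2l (p ^ size S)) ?expn_gt0 ?prime_gt0 // -expnD.
  apply: leq_trans (card_annihilator _ p_pr).
  rewrite card_mx mul1n card_Fp // leq_exp2l //; lia.
have ie : 1 <= eps^-1 by rewrite invf_ge1.
have ie2 : eps^-1 <= 288 / eps ^+ 2.
  have : eps^-1 * 1 <= eps^-1 * eps^-1 by rewrite ler_wpM2l // invr_ge0 ltW.
  by rewrite -exprVn expr2; lra.
have epsH : 2 <= eps * #|annihilator S|%:R.
  rewrite mulrC -ler_pdivrMr //; apply: le_trans ps; apply: le_trans sbig.
  have s0 : 0 <= s%:R :> R by [].
  have : eps^-1 * 1 <= eps^-1 * eps^-1 by rewrite ler_wpM2l // invr_ge0 ltW.
  by rewrite -exprVn expr2; lra.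
have [S' szS' hS'] := energy_increment epsH few.
exists S'.
  rewrite iterS; apply: (@leq_trans (p ^ (2 * size S + s))); last by rewrite leq_exp2l.
  rewrite expnD -(ler_nat R) natrD [(2 * size S')%:R]natrM natrM.
  set P : R := (p ^ (2 * size S))%:R in szS' *.
  have P1 : 1 <= P by rewrite ler1n expn_gt0 prime_gt0.
  have SP : (size S)%:R <= P.
    by rewrite ler_nat; apply: leq_trans (ltnW (ltn_expl _ p1)) _;
       rewrite leq_exp2l // leq_pmull.
  (* The three summands dominate [2 * size S], twice the number of added frequencies, and [s]. *)
  have : P * (2 + 288 / eps ^+ 2 + s%:R) <= P * (p ^ s)%:R.
    by rewrite ler_wpM2l // (le_trans ler01).
  apply: le_trans; have : 1 * s%:R <= P * s%:R by rewrite ler_wpM2r.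
  lra.
apply: le_trans hS _; rewrite exprSr -mulrA.
have g0 : 0 <= gamma by exact: le_trans cg.
apply: ler_wpM2l; first by rewrite exprn_ge0 // mulr_ge0.
have := energy_excess_ge0 S'; have := energy_excess_ge0 S => f0 f0'.
have h1 : c * phi S' <= gamma * phi S' by rewrite ler_wpM2r.
have h2 : 0 <= c * phi S by rewrite mulr_ge0.
have h3 : 0 <= gamma * eps by rewrite mulr_ge0 // ltW.
have h4 : 0 < eps := eps0.
move: (phi S) (phi S') hS' f0 f0' h1 h2 => u v; lra.
Qed.

(** After [m] steps, [phi S + eps / 4] is still at most 5 / 4. *)
Lemma energy_bound gamma (s m : nat) : c <= gamma ->
  (forall d, d != 0 -> (ap3_count A d)%:R <= beta * N) ->
  eps <= 1 -> 2 + 288 / eps ^+ 2 + s%:R <= (p ^ s)%:R ->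
  (iter m (expn p) s <= n)%N ->
  eps <= 5 * (4 * gamma) ^+ m.
Proof.
move=> cg few eps1 sbig nbig.
have [S _ hS] := energy_iteration cg few eps1 sbig nbig.
have g0 : 0 <= (4 * gamma) ^+ m.
  by rewrite exprn_ge0 // mulr_ge0 // (le_trans density_ge0).
have : (4 * gamma) ^+ m * (phi S + eps / 4) <= (4 * gamma) ^+ m * (1 + 1 / 4).
  by rewrite ler_wpM2l // lerD ?energy_excess_le1 // ler_pM2r // invr_gt0.
lra.
Qed.

End Increment.
End Refinement.

(** * Starting height and existence of a popular difference *)

Lemma exists_least (P : nat -> Prop) n : P n ->
  exists2 k, P k & (k <= n)%N /\ forall j, P j -> (k <= j)%N.
Proof.
(* [P] need not be decidable; classical truth values turn it into a boolean predicate. *)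
move=> Pn; have ex : exists n, `[< P n >] by exists n; apply/asboolP.
have [k /asboolP Pk kmin] := ex_minnP ex; exists k => //.
by split=> [|j Pj]; apply: kmin; apply/asboolP.
Qed.

(* A dimension [s] this large absorbs the factor 288 / eps ^+ 2 by which the
   codimension bound of [energy_increment] exceeds a pure exponential. *)
Lemma start_height_large (R : realFieldType) (eps : R) (k p : nat) (s := (2 * k + 12)%N) :
  0 < eps -> eps^-1 <= k%:R -> (1 < p)%N ->
  2 + 288 / eps ^+ 2 + s%:R <= (p ^ s)%:R.
Proof.
move=> e0 ek p1.
have kk : (k < 2 ^ k)%N by exact: ltn_expl.
(* [2 ^ s] is 4096 times the square of [2 ^ k], and [k < 2 ^ k]. *)
have nat_bound : (2 + 288 * (k * k) + s <= p ^ s)%N.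
  apply: (@leq_trans (2 ^ s)); last by rewrite leq_exp2r // /s addnS.
  have -> : (2 ^ s = 4096 * (2 ^ k * 2 ^ k))%N.
    by rewrite /s expnD mul2n -addnn expnD mulnC.
  rewrite /s; move: kk; set t := (2 ^ k)%N => kk.
  have : (k * k <= t * t)%N by rewrite leq_mul // ltnW.
  have : (t <= t * t)%N by rewrite leq_pmull // expn_gt0.
  lia.
have : (2 + 288 * (k * k) + s)%:R <= (p ^ s)%:R :> R by rewrite ler_nat.
apply: le_trans; rewrite 2!natrD lerD2r lerD2l natrM -exprVn expr2 ler_pM2l ?ltr0n //.
rewrite natrM.
by rewrite ler_pM // invr_ge0 ltW.
Qed.

(** As [d *+ 2] is 0, a progression is a pair [x], [x + d] in [A], and every pair of points of [A]
    arises once. *)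
Lemma sum_ap3_count_char2 n (A : {set 'rV['F_2]_n}) :
  (\sum_d ap3_count A d = #|A| ^ 2)%N.
Proof.
have dbl (d : 'rV['F_2]_n) : d *+ 2 = 0.
  apply/rowP => i; rewrite mulr2n !mxE; move: (d 0 i) => a.
  by apply: val_inj; case: a => [[|[|]]].
transitivity (\sum_(x in A) \sum_(y in A) 1)%N; last first.
  by rewrite !sum1_card sum_nat_const -mulnn.
transitivity (\sum_d \sum_(x in A | (x + d)%R \in A) 1)%N.
  apply: eq_bigr => d _; rewrite /ap3_count -sum1_card; apply: eq_bigl => x.
  by rewrite inE dbl addr0; case: (x \in A); rewrite ?andbT.
rewrite (exchange_big_dep (mem A)) => [|d x _ /andP[]] //=; apply: eq_bigr => x xA.
by rewrite [RHS](reindex_inj (addrI x)) /=; apply: eq_bigl => d; rewrite xA.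
Qed.

Lemma popular_difference (R : rcfType) (p n s m : nat) (A : {set 'rV['F_p]_n})
    (beta eps gamma : R) : prime p ->
  0 <= beta -> 0 < eps <= 1 -> gamma <= 60^-1 -> beta <= (1 - gamma) ^+ 3 - eps ->
  (1 - gamma) * (p ^ n)%:R <= #|A|%:R ->
  5 * (4 * gamma) ^+ m < eps -> 2 + 288 / eps ^+ 2 + s%:R <= (p ^ s)%:R ->
  (iter m (expn p) s <= n)%N ->
  exists2 d, d != 0 & beta * (p ^ n)%:R <= (ap3_count A d)%:R.
Proof.
move=> p_pr beta0 /andP[eps0 eps1] g60 betale Ag m_big s_big n_big.
pose V := 'rV['F_p]_n.
have cV : #|{: V}| = (p ^ n)%N by rewrite card_mx mul1n card_Fp.
have N0 : 0 < (p ^ n)%:R :> R by rewrite ltr0n expn_gt0 prime_gt0.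
have [/existsP[d /andP[]]|] :=
  boolP [exists d : V, (d != 0) && (beta * (p ^ n)%:R <= (ap3_count A d)%:R)].
  by exists d.
rewrite negb_exists => /forallP none; exfalso.
have few (d : V) : d != 0 -> (ap3_count A d)%:R <= beta * (p ^ n)%:R.
  by move=> d0; have := none d; rewrite d0 -ltNge => /ltW.
(* The true density of the complement, which may lie below [gamma]. *)
pose c : R := 1 - #|A|%:R / (p ^ n)%:R.
have cA : #|A|%:R = (1 - c) * (p ^ n)%:R by rewrite /c subKr divfK ?lt0r_neq0.
have cg : c <= gamma.
  by move: Ag; rewrite cA ler_pM2r // lerD2l lerN2.
have c0 : 0 <= c.
  rewrite subr_ge0 ler_pdivrMr // mul1r ler_nat -cV; exact: max_card.
have c1 : c <= 1 by lra.
have betac : beta <= (1 - c) ^+ 3 - eps.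
  apply: le_trans betale _; rewrite lerD2r lerXn2r ?nnegrE; lra.
have sn : (s <= n)%N.
  apply: leq_trans n_big; elim: (m) => // k IH; rewrite iterS.
  by apply: leq_trans IH (ltnW (ltn_expl _ (prime_gt1 p_pr))).
(* For p = 2, averaging over the nonzero [d] gives [2 ^ n * eps <= 1], against the size of
   [2 ^ s]. *)
have [p2|p2] := leqP p 2.
  have {p2} p2 : p = 2%N by apply/eqP; rewrite eqn_leq p2 prime_gt1.
  subst p; have := sum_ap3_count_char2 A.
  move/(congr1 (fun k => k%:R : R)); rewrite natr_sum (bigD1 0) //= natrX cA.
  move=> e.
  have h1 : (ap3_count A 0)%:R <= (2 ^ n)%:R :> R by rewrite ler_nat -cV max_card.
  have h2 : \sum_(d : V | d != 0) (ap3_count A d)%:R <= (2 ^ n)%:R * (beta * (2 ^ n)%:R).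
    rewrite -{1}cV mulr_natl -sumr_const [leRHS](bigD1 0) //=.
    by apply: ler_wpDl; [rewrite mulr_ge0 | apply: ler_sum].
  have h3 : (2 ^ n)%:R * ((1 - c) ^+ 2 - beta) <= 1.
    rewrite -(ler_pM2l N0); move: e h1 h2; lra.
  have h4 : (1 - c) ^+ 3 <= (1 - c) ^+ 2 by rewrite exprS ler_piMl ?exprn_ge0 //; lra.
  have h5 : (2 ^ n)%:R * eps <= 1.
    by apply: le_trans h3; rewrite ler_wpM2l //; lra.
  have h6 : (2 ^ s)%:R <= (2 ^ n)%:R :> R by rewrite ler_nat leq_exp2l.
  have h7 : (2 + 288 / eps ^+ 2 + s%:R) * eps <= 1.
    apply: le_trans h5; apply: ler_wpM2r; [exact: ltW | exact: le_trans s_big h6].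
  have ie : 1 <= eps^-1 by rewrite invf_ge1.
  have e0 : eps != 0 by rewrite lt0r_neq0.
  have h8 : (288 / eps ^+ 2) * eps = 288 * eps^-1 by field.
  have h9 : 0 <= s%:R * eps by rewrite mulr_ge0 // ltW.
  lra.
have gc : \sum_x compl_ind R A x = #|{: V}|%:R * c.
  have <- : \sum_(x : V) (1 - (x \in A)%:R) = #|{: V}|%:R * c.
    rewrite sumrB sumr_const -natr_sum -[in X in _ - X]big_mkcond sum1_card.
    by rewrite cV cA; ring.
  by apply: eq_bigr => x _; rewrite /compl_ind; case: (x \in A); rewrite ?subrr ?subr0.
have cle : c <= 60^-1 by exact: le_trans g60.
have := few; rewrite -cV => few'.
have := energy_bound p_pr p2 gc cle beta0 betac eps0 cg few' eps1 s_big n_big.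
by rewrite leNgt m_big.
Qed.

(** * Tower bounds *)

Local Close Scope ring_scope.
From Stdlib Require Import Reals Lra Lia.

Section Towers.
Local Open Scope R_scope.

(** Since ln 2 > 1/2, the power is at least (1 + x/4)^2 = (x/4 - 1)^2 + x. *)
Lemma le_Rpower2 x : 0 <= x -> x <= Rpower 2 x.
Proof.
move=> x0; have l2 := ln_lt_2.
have e1 := exp_ineq1_le (x * ln 2 / 2).
have -> : Rpower 2 x = exp (x * ln 2 / 2) * exp (x * ln 2 / 2).
  by rewrite -exp_plus /Rpower; congr exp; field.
have h : x / 4 <= x * ln 2 / 2 by Lra.nra.
have h2 : (1 + x / 4) * (1 + x / 4) <= exp (x * ln 2 / 2) * exp (x * ln 2 / 2).
  by apply: Rmult_le_compat; Lra.lra.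
apply: Rle_trans h2; have := Rle_0_sqr (x / 4 - 1); rewrite /Rsqr; Lra.lra.
Qed.

(** The power is at least (x/4)^4, and x^3 is at least 16^3. *)
Lemma Rpower2_ge16 x : 16 <= x -> 16 * x <= Rpower 2 x.
Proof.
move=> x16.
have -> : Rpower 2 x = (Rpower 2 (x / 4) * Rpower 2 (x / 4)) *
                       (Rpower 2 (x / 4) * Rpower 2 (x / 4)).
  by rewrite -!Rpower_plus; congr Rpower; field.
have h : x / 4 <= Rpower 2 (x / 4) by apply: le_Rpower2; Lra.lra.
have h2 : x / 4 * (x / 4) <= Rpower 2 (x / 4) * Rpower 2 (x / 4).
  by apply: Rmult_le_compat; Lra.lra.
have h3 : (x / 4 * (x / 4)) * (x / 4 * (x / 4)) <=
   (Rpower 2 (x / 4) * Rpower 2 (x / 4)) * (Rpower 2 (x / 4) * Rpower 2 (x / 4)).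
  by apply: Rmult_le_compat => //; Lra.nra.
apply: Rle_trans h3.
have h4 : 256 <= x * x by Lra.nra.
have h5 : 256 * 16 <= x * x * x by Lra.nra.
have -> : x / 4 * (x / 4) * (x / 4 * (x / 4)) = (x * x * x) * x / 256 by field.
by Lra.nra.
Qed.

Lemma Rpower_ge2 a x : 2 <= a -> 0 <= x -> Rpower 2 x <= Rpower a x.
Proof. by move=> a2 x0; apply: Rle_Rpower_l => //; Lra.lra. Qed.

Lemma Tow_le_succ a k r : 2 <= a -> 0 <= r ->
  0 <= Tow a k r /\ Tow a k r <= Tow a k.+1 r.
Proof.
move=> a2 r0; have step x : 0 <= x -> x <= Rpower a x.
  by move=> x0; apply: Rle_trans (le_Rpower2 x0) (Rpower_ge2 a2 x0).
elim: k => [|k [IH1 IH2]]; first by split=> //; apply: step.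
have h : 0 <= Tow a k.+1 r by apply: Rle_trans IH1 IH2.
by split => //; apply: step.
Qed.

(** Three levels climb through 2, 4 and 16, the fourth gains the factor 16, and monotonicity handles
    the other five. *)
Lemma Tow_ge16 a x : 2 <= a -> 1 <= x -> 16 * x <= Tow a 9 x.
Proof.
move=> a2 x1; have x0 : 0 <= x by Lra.lra.
have T k := Tow_le_succ k a2 x0.
have up k y : 0 <= y -> y <= Tow a k x -> Rpower 2 y <= Tow a k.+1 x.
  move=> y0 yT; apply: Rle_trans (Rpower_ge2 a2 y0) _.
  by apply: Rle_Rpower => //; Lra.lra.
have p1 : Rpower 2 1 = 2 by apply: Rpower_1; Lra.lra.
have p2 : Rpower 2 2 = 4.
  have := Rpower_plus 1 1 2; rewrite p1 (_ : 1 + 1 = 2); Lra.lra.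
have p4 : Rpower 2 4 = 16.
  have := Rpower_plus 2 2 2; rewrite p2 (_ : 2 + 2 = 4); Lra.lra.
have t1 : 2 <= Tow a 1 x by rewrite -[X in X <= _]p1; apply: up => //; Lra.lra.
have t2 : 4 <= Tow a 2 x by rewrite -[X in X <= _]p2; apply: up => //; Lra.lra.
have t3 : 16 <= Tow a 3 x by rewrite -[X in X <= _]p4; apply: up => //; Lra.lra.
have x3 : x <= Tow a 3 x.
  have [_ u0] := T O; have [_ u1] := T 1%nat; have [_ u2] := T 2%nat.
  exact: Rle_trans u0 (Rle_trans _ _ _ u1 u2).
have t4 : 16 * x <= Tow a 4 x.
  apply: Rle_trans (up 3%nat _ _ (Rle_refl _)); last by Lra.lra.
  by apply: Rle_trans (Rpower2_ge16 t3); Lra.lra.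
apply: Rle_trans t4 _.
have [_ u4] := T 4%nat; have [_ u5] := T 5%nat; have [_ u6] := T 6%nat.
have [_ u7] := T 7%nat; have [_ u8] := T 8%nat.
exact: Rle_trans u4 (Rle_trans _ _ _ u5 (Rle_trans _ _ _ u6 (Rle_trans _ _ _ u7 u8))).
Qed.

Lemma INR_expn (p k : nat) : (0 < p)%nat -> INR (expn p k) = Rpower (INR p) (INR k).
Proof.
move=> p0; rewrite Rpower_pow; last by apply: (lt_INR 0); apply/ssrnat.ltP.
by elim: k => [|k IH] //=; rewrite expnS mult_INR IH.
Qed.

Lemma INR_iter_expn_le (p s m k : nat) r : (1 < p)%nat -> INR s <= Tow (INR p) k r ->
  INR (iter m (expn p) s) <= Tow (INR p) (m + k) r.
Proof.
move=> p1 hs; elim: m => [//|m IH].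
rewrite iterS addSn INR_expn ?(ltnW p1) //=; apply: Rle_Rpower => //.
by apply: (le_INR 1); apply/ssrnat.leP/ltnW.
Qed.

(** Neither rounding up nor clamping at 0 lowers the value. *)
Lemma le_INR_height x : x <= INR (height x).
Proof.
rewrite /height /Rceil; set z := (_ - _)%Z.
have zx : x <= IZR z.
  rewrite minus_IZR; have := archimed (- x); Lra.lra.
have [z0|z0] := Z.lt_ge_cases z 0.
  have : IZR z <= -1 by apply: (IZR_le _ (-1)); Lia.lia.
  have := pos_INR (Z.to_nat z); Lra.lra.
by rewrite INR_IZR_INZ Znat.Z2Nat.id.
Qed.

Lemma exists_nat_ge x : 0 < x -> exists2 k : nat, x <= INR k & INR k <= x + 1.
Proof.
move=> x0; have [h1 h2] := archimed x; exists (Z.to_nat (up x)).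
all: rewrite INR_IZR_INZ Znat.Z2Nat.id; try Lra.lra.
all: by apply: le_IZR; Lra.lra.
Qed.
End Towers.

(** * Transfer to the standard-library reals and the tower bound *)

Lemma popular_difference_R (p n k m : nat) (A : {set 'rV['F_p]_n})
    (beta eps gamma : R) : prime p ->
  (0 <= beta)%R -> (0 < eps)%R -> (eps < 1)%R -> (gamma <= / 60)%R ->
  (beta <= pow (1 - gamma) 3 - eps)%R ->
  ((1 - gamma) * INR (expn p n) <= INR #|A|)%R ->
  (5 * pow (4 * gamma) m < eps)%R -> (/ eps <= INR k)%R ->
  leq (iter m (expn p) (addn (muln 2 k) 12)) n ->
  exists2 d, d != GRing.zero & (beta * INR (expn p n) <= INR (ap3_count A d))%R.
Proof.
move=> p_pr b0 e0 e1 g60 ble Ag mb ek nb.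
have natrR j : GRing.natmul (GRing.one _ : R) j = IZR (Z.of_nat j).
  by rewrite -INRE INR_IZR_INZ.
have [//||||||||d d0 hd] :=
  @popular_difference R p n (addn (muln 2 k) 12) m A beta eps gamma p_pr.
- exact/RleP.
- by apply/andP; split; [exact/RltP | exact/RleP/Rlt_le].
- by rewrite natrR /=; exact/RleP.
- by rewrite -RpowE; exact/RleP.
- by rewrite -!INRE; exact/RleP.
- by rewrite -RpowE !natrR /=; exact/RltP.
- apply: start_height_large; [exact/RltP| by rewrite -INRE; exact/RleP |].
  exact: prime_gt1.
- exact: nb.
- by exists d => //; apply/RleP; rewrite !INRE.
Qed.

Theorem theorem15 (p : nat) (alpha beta : R) :
  prime p ->
  Rle (Rdiv 59 60) alpha -> Rlt alpha 1 ->
  Rle 0 beta -> Rlt beta (Rmult alpha (Rmult alpha alpha)) ->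
  let gamma := Rminus 1 alpha in
  let eps := Rminus (Rmult alpha (Rmult alpha alpha)) beta in
  exists N : nat, is_np p alpha beta N /\
    Rle (INR N)
      (Tow (INR p)
           (height (Rplus (Rdiv (log2 eps) (log2 (Rmult 36 gamma))) 9))
           (Rinv eps)).
Proof.
move=> p_pr a59 a1 b0 ba gamma eps.
have p1 := prime_gt1 p_pr.
have eps0 : (0 < eps)%R by rewrite /eps; Lra.lra.
have eps1 : (eps < 1)%R.
  have : (alpha * alpha < 1)%R by Lra.nra.
  by rewrite /eps; Lra.nra.
have g0 : (0 < gamma)%R by rewrite /gamma; Lra.lra.
have g60 : (gamma <= / 60)%R by rewrite /gamma; Lra.lra.
have ie1 : (1 < / eps)%R by rewrite -Rinv_1; apply: Rinv_lt_contravar; Lra.lra.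
have [k ek ke] := exists_nat_ge (Rlt_trans _ _ _ Rlt_0_1 ie1).
have k1 : 1 < k by apply/ssrnat.ltP/INR_lt; rewrite /=; Lra.lra.
(* [s] is at most [2 / eps + 14], hence at most [16 / eps], which nine tower levels reach. *)
pose s := addn (muln 2 k) 12.
set h := height _.
have lneps : (ln eps < 0)%R by rewrite -ln_1; apply: ln_increasing.
(* [36 * gamma] is at most 3 / 5; with both logarithms negative, their quotient is positive. *)
have lng : (ln (36 * gamma) < 0)%R by rewrite -ln_1; apply: ln_increasing; Lra.lra.
have lE : (log2 eps / log2 (36 * gamma) = ln eps / ln (36 * gamma))%R.
  have := ln_lt_2; rewrite /log2 => l2; field; Lra.lra.
have L0 : (0 < ln eps / ln (36 * gamma))%R.
  have -> : (ln eps / ln (36 * gamma) = (- ln eps) / (- ln (36 * gamma)))%R.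
    by field; Lra.lra.
  by apply: Rdiv_lt_0_compat; Lra.lra.
have hL : (ln eps / ln (36 * gamma) + 9 <= INR h)%R.
  by rewrite -lE; exact: le_INR_height.
have h9 : 9 < h by apply/ssrnat.ltP/INR_lt; rewrite [INR 9]/=; Lra.lra.
(* [m] levels pay for the iteration and nine for the starting height. *)
pose m := subn h 9; have hE : h = addn m 9 by rewrite /m subnK // ltnW.
have m0 : 0 < m by rewrite subn_gt0.
have mL : (INR m * ln (36 * gamma) <= ln eps)%R.
  have : (ln eps / ln (36 * gamma) <= INR m)%R.
    by move: hL; rewrite hE plus_INR [INR 9]/=; Lra.lra.
  have {2}-> : (ln eps = ln (36 * gamma) * (ln eps / ln (36 * gamma)))%R.
    by field; Lra.lra.
  by move=> ?; rewrite Rmult_comm; apply: Rmult_le_compat_neg_l => //; Lra.lra.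
have g36 : (pow (36 * gamma) m <= eps)%R.
  rewrite -Rpower_pow; last by Lra.lra.
  rewrite /Rpower -[X in (_ <= X)%R](exp_ln eps) //; move: mL => [?|->]; last by right.
  by left; apply: exp_increasing.
(* The constant 36 enters here: [(4 * gamma) ^ m] is [(36 * gamma) ^ m / 9 ^ m], at most [eps / 9]
   because [m] is positive, and 5 < 9. *)
have m_big : (5 * pow (4 * gamma) m < eps)%R.
  have -> : (4 * gamma = 36 * gamma * / 9)%R by field.
  rewrite Rpow_mult_distr.
  have h1 : (0 < pow (/ 9) m)%R by apply: pow_lt; Lra.lra.
  have h2 : (pow (/ 9) m <= / 9)%R.
    case: (m) m0 => // i _ /=.
    by have := pow_incr (/ 9) 1 i; rewrite pow1; Lra.lra.
  have h3 : (pow (36 * gamma) m * pow (/ 9) m <= eps * / 9)%R.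
    by apply: Rmult_le_compat => //; [apply: pow_le | ]; Lra.lra.
  by Lra.lra.
pose N0 := iter m (expn p) s.
have N0_pos : (0 < N0)%nat.
  by rewrite /N0; case: (m) => [|i] /=; rewrite /s ?addnS // expn_gt0 prime_gt0.
have N0_np : np_prop p alpha beta N0.
  move=> n nN A /Rge_le dA.
  have pn0 : (0 < INR (expn p n))%R.
    by apply: (lt_INR 0); apply/ssrnat.ltP; rewrite expn_gt0 prime_gt0.
  have [d d0 hd] : exists2 d : 'rV['F_p]_n, d != GRing.zero
      & (beta * INR (expn p n) <= INR (ap3_count A d))%R.
    apply: (popular_difference_R p_pr b0 eps0 eps1 g60 _ _ m_big ek nN).
      by rewrite /eps /gamma /=; Lra.lra.
    have -> : (1 - gamma = alpha)%R by rewrite /gamma; Lra.lra.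
    move: dA; rewrite /density => /(Rmult_le_compat_r _ _ _ (Rlt_le _ _ pn0)).
    by rewrite /Rdiv Rmult_assoc Rinv_l ?Rmult_1_r //; Lra.lra.
  exists d; split => //; apply: Rle_ge.
  rewrite /ap3_density; apply: (Rmult_le_reg_r _ _ _ pn0).
  by rewrite /Rdiv Rmult_assoc Rinv_l ?Rmult_1_r //; Lra.lra.
have [N [Npos Nnp] [NN0 Nmin]] :=
  @exists_least (fun k => (0 < k)%nat /\ np_prop p alpha beta k) N0 (conj N0_pos N0_np).
exists N; split; first by split => //; split => // M M0 Mnp; apply: Nmin.
apply: Rle_trans (le_INR _ _ (ssrnat.leP NN0)) _.
rewrite hE; apply: INR_iter_expn_le => //.
have p2 : (2 <= INR p)%R by apply: (le_INR 2); apply/ssrnat.leP.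
apply: Rle_trans (Tow_ge16 p2 (Rlt_le _ _ ie1)).
rewrite /s plus_INR mult_INR [INR 2]/= [INR 12]/=; Lra.lra.
Qed.
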